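(* Let $(h_n)_{n\ge0}$ be a non-increasing sequence of positive real numbers and let $(x_n)_{n\ge0}$ be the solution of $x_{n+1}=x_n(1-h_nx_n^2)$, $n=0,1,2,\dots$, with initial value $x_0\in\mathbb R$, $x_0\ne0$. Suppose that there exists $N\in\mathbb N$ such that $h_Nx_N^2<1$, and that $\sum_{j=1}^\infty h_j=\infty$. Then $\lim_{n\to\infty}x_n=0$. *)

(* Defs.v *)
(* Stdlib real numbers, with limits of sequences from Coquelicot. *)
From Stdlib Require Export Reals.
From Coquelicot Require Export Coquelicot.

(* Main.v *)
Require Import Defs.
From Stdlib Require Import Reals.
From Coquelicot Require Import Coquelicot.
From Stdlib Require Import Lra Lia Classical.
Open Scope R_scope.

(** Work with [u n = x n ^ 2], which satisfies [u (S n) = u n * (1 - h n * u n) ^ 2].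
    As soon as [h N * u N < 1], the factor [1 - h n * u n] lies between 0 and 1 for
    every [n >= N]: then [u] decreases, and since [h] does not increase,
    [h n * u n] stays below 1 ([small_forever]).  From there on
    [u (S n) <= u n - h n * u n ^ 2] ([square_step]).

    If [u] stayed above some [e > 0], each step would cost it at least
    [e ^ 2 * h n]; the nonnegative [u] would then bound the partial sums of [h],
    which diverge.  So [u] drops below every [e > 0], and being
    decreasing it remains there; this gives [x n -> 0]. *)

(** Only one of the two factors [1 - a * y ^ 2] of the new square is kept: the
    other is at most 1. *)
Lemma square_step (a y : R) :
  0 <= a -> a * y ^ 2 < 1 ->
  (y * (1 - a * y ^ 2)) ^ 2 <= y ^ 2 - a * (y ^ 2) ^ 2.
Proof.
  intros Ha Hsmall.
  assert (Hu : 0 <= y ^ 2) by apply pow2_ge_0.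
  assert (Hau : 0 <= a * y ^ 2) by (apply Rmult_le_pos; assumption).
  assert (Hslack : 0 <= y ^ 2 * ((a * y ^ 2) * (1 - a * y ^ 2)))
    by (apply Rmult_le_pos; [exact Hu | apply Rmult_le_pos; lra]).
  apply Rminus_le_0.
  replace (y ^ 2 - a * (y ^ 2) ^ 2 - (y * (1 - a * y ^ 2)) ^ 2)
    with (y ^ 2 * ((a * y ^ 2) * (1 - a * y ^ 2))) by ring.
  exact Hslack.
Qed.

Lemma square_decreases (a y : R) :
  0 <= a -> a * y ^ 2 < 1 -> (y * (1 - a * y ^ 2)) ^ 2 <= y ^ 2.
Proof.
  intros Ha Hsmall.
  assert (Hstep := square_step a y Ha Hsmall).
  assert (0 <= a * (y ^ 2) ^ 2)
    by (apply Rmult_le_pos; [assumption | apply pow2_ge_0]).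
  lra.
Qed.

Lemma small_forever (h x : nat -> R) (N : nat) :
  (forall n, 0 < h n) -> Un_decreasing h ->
  (forall n, x (S n) = x n * (1 - h n * x n ^ 2)) ->
  h N * x N ^ 2 < 1 ->
  forall n, (N <= n)%nat -> h n * x n ^ 2 < 1.
Proof.
  intros h_pos h_noninc x_rec HN n Hn.
  induction Hn as [| n Hn IH]; [exact HN |].
  apply Rle_lt_trans with (h n * x n ^ 2); [| exact IH].
  apply Rmult_le_compat.
  - left; apply h_pos.
  - apply pow2_ge_0.
  - apply h_noninc.
  - rewrite x_rec. apply square_decreases; [left; apply h_pos | exact IH].
Qed.

(** The quantity [u (S n) + e ^ 2 * (h 1 + ... + h n)] cannot increase while [u] is
    at least [e], because each step of [u] pays for the new term of the sum. *)
Lemma partial_sums_bounded (h u : nat -> R) (N : nat) (e : R) :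
  0 < e -> (forall n, 0 <= h n) ->
  (forall n, (N <= n)%nat -> u (S n) <= u n - h n * u n ^ 2) ->
  (forall n, (N <= n)%nat -> e <= u n) ->
  forall n, (N <= n)%nat ->
  e ^ 2 * sum_n_m h 1 n <= u (S N) + e ^ 2 * sum_n_m h 1 N.
Proof.
  intros He h_nonneg Hstep Hlow n Hn.
  enough (Hmono : u (S n) + e ^ 2 * sum_n_m h 1 n
                  <= u (S N) + e ^ 2 * sum_n_m h 1 N)
    by (assert (e <= u (S n)) by (apply Hlow; lia); lra).
  induction Hn as [| n Hn IH]; [lra |].
  rewrite sum_n_Sm by lia.
  change plus with Rplus.
  assert (Hs : u (S (S n)) <= u (S n) - h (S n) * u (S n) ^ 2)
    by (apply Hstep; lia).
  assert (Hcost : h (S n) * e ^ 2 <= h (S n) * u (S n) ^ 2).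
  { apply Rmult_le_compat_l; [apply h_nonneg |].
    apply pow_incr; split; [lra | apply Hlow; lia]. }
  lra.
Qed.

Theorem lemma9 (h x : nat -> R)
  (h_pos : forall n : nat, 0 < h n)
  (h_noninc : Un_decreasing h)
  (x_rec : forall n : nat, x (S n) = x n * (1 - h n * x n ^ 2))
  (x0_neq0 : x 0%nat <> 0)
  (h_small : exists N : nat, h N * x N ^ 2 < 1)
  (h_sum : is_lim_seq (fun n : nat => sum_n_m h 1 n) p_infty) :
  is_lim_seq x (Finite 0).
Proof.
  destruct h_small as [N HN].
  assert (Hsmall := small_forever h x N h_pos h_noninc x_rec HN).
  assert (Hdrop : forall e, 0 < e -> exists n, (N <= n)%nat /\ x n ^ 2 < e).
  { intros e He. apply NNPP; intro Hno.
    assert (Hlow : forall n, (N <= n)%nat -> e <= x n ^ 2).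
    { intros n Hn. apply Rnot_lt_le; intro Hlt. apply Hno; exists n; auto. }
    assert (He2 : 0 < e ^ 2) by (apply pow_lt; exact He).
    assert (Hbound : forall n, (N <= n)%nat -> e ^ 2 * sum_n_m h 1 n
                     <= x (S N) ^ 2 + e ^ 2 * sum_n_m h 1 N).
    { apply (partial_sums_bounded h (fun n => x n ^ 2) N e He).
      - intro n; left; apply h_pos.
      - intros n Hn. rewrite x_rec.
        apply square_step; [left; apply h_pos | apply Hsmall; exact Hn].
      - exact Hlow. }
    set (B := x (S N) ^ 2 + e ^ 2 * sum_n_m h 1 N) in Hbound.
    apply is_lim_seq_spec in h_sum.
    destruct (h_sum (B / e ^ 2)) as [M HM].
    specialize (HM (max N M) (Nat.le_max_r _ _)).
    specialize (Hbound (max N M) (Nat.le_max_l _ _)).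
    apply (Rmult_lt_compat_l (e ^ 2)) in HM; [| exact He2].
    replace (e ^ 2 * (B / e ^ 2)) with B in HM by (field; lra).
    lra. }
  apply is_lim_seq_spec; intro eps.
  assert (Heps := cond_pos eps).
  destruct (Hdrop (eps ^ 2)) as [n0 [Hn0 Hx]]; [apply pow_lt; exact Heps |].
  exists n0; intros n Hn.
  assert (Hxn : x n ^ 2 < eps ^ 2).
  { induction Hn as [| n Hn IH]; [exact Hx |].
    apply Rle_lt_trans with (x n ^ 2); [| exact IH].
    rewrite x_rec.
    apply square_decreases; [left; apply h_pos | apply Hsmall; lia]. }
  rewrite Rminus_0_r, <- (Rabs_pos_eq eps) by lra.
  apply Rsqr_lt_abs_0. rewrite !Rsqr_pow2. exact Hxn.
Qed.
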